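(* Let $0<r<1$, let $m$ be a positive integer, let $i_1,\dots,i_N$ be pairwise distinct integers, and let $\mathcal U=\{m i_1,\dots,m i_N\}$ (i.e. $l_k=m i_k$ for $k=1,\dots,N$). Let $D=\lfloor 2mr\rfloor$ and $$\alpha_{11}=\frac{D}{m}\Big(1-\frac{D}{4m}-\frac1{4m}\Big),\qquad \beta_{11}=\alpha_{11}+\frac1m,$$ $$\alpha_{22}=\frac{D}{4m^2}(D-1),\qquad \beta_{22}=\frac{D}{4m^2}(D+1)+\frac{r}{m}.$$ If $mr$ is not an integer, then for every $j=1,\dots,N$ $$\alpha_{11}<\lambda_j(S_{11})<\beta_{11},\qquad \alpha_{22}<\lambda_j(S_{22})<\beta_{22},$$ where $\lambda_1(A),\dots,\lambda_N(A)$ denote the eigenvalues of an $N\times N$ matrix $A$, and $S_{11},S_{22}$ are the real symmetric matrices associated with $\mathcal U$, $\omega$ and $r$.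
   Context: Let $\omega>0$ be a real number, $r\in(0,1)$ the oversampling parameter, and $t_o=2\pi r/\omega$ (so $r=\omega t_o/(2\pi)$). Write $\mathrm{sinc}(x)=\sin(x)/x$ for $x\ne0$ and $\mathrm{sinc}(0)=1$; $\lfloor a\rfloor$ is the largest integer less than or equal to $a$. Define $\widetilde\varphi_1,\widetilde\varphi_2:\mathbb R\to\mathbb R$ by $$\widetilde\varphi_1(x)=\frac1{\sqrt{2\pi}}\Big[2r(1-r)\,\mathrm{sinc}(\omega x)+r^2\,\mathrm{sinc}^2\big(\tfrac{\omega x}{2}\big)\Big],\qquad \widetilde\varphi_2(x)=-\frac1{\sqrt{2\pi}}\,r^2\,x\,\mathrm{sinc}^2\big(\tfrac{\omega x}{2}\big),$$ and let $\widetilde\varphi_2'$ be the derivative of $\widetilde\varphi_2$. For a set $\mathcal U=\{l_1,\dots,l_N\}$ of $N\ge1$ distinct integers, the real symmetric $N\times N$ matrices $S_{11},S_{22}$ are defined, for $k,j=1,\dots,N$, by $$S_{11}(k,j)=\sqrt{2\pi}\,\widetilde\varphi_1((l_k-l_j)t_o),\qquad S_{22}(k,j)=-\sqrt{2\pi}\,\widetilde\varphi_2'((l_k-l_j)t_o).$$ *)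

(* Defs.v *)
From HB Require Import structures.
From mathcomp Require Import all_boot all_order all_algebra.
From mathcomp Require Import complex.
From mathcomp Require Import all_classical all_reals all_analysis.
Set Implicit Arguments.
Unset Strict Implicit.
Unset Printing Implicit Defensive.
Import Order.TTheory GRing.Theory Num.Theory.
Import numFieldNormedType.Exports.
Local Open Scope classical_set_scope.
Local Open Scope ring_scope.

Definition sinc (R : realType) (x : R) : R := if x == 0 then 1 else sin x / x.

Definition sampling_step (R : realType) (omega r : R) : R := 2 * pi * r / omega.

Definition phi1 (R : realType) (omega r x : R) : R :=
  (Num.sqrt (2 * pi))^-1 *
  (2 * r * (1 - r) * sinc (omega * x) + r ^+ 2 * sinc (omega * x / 2) ^+ 2).

Definition phi2 (R : realType) (omega r x : R) : R :=
  - (Num.sqrt (2 * pi))^-1 * r ^+ 2 * x * sinc (omega * x / 2) ^+ 2.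

Definition S11 (R : realType) (omega r : R) (N : nat) (l : 'I_N -> int) :
    'M[R]_N :=
  \matrix_(k, j) (Num.sqrt (2 * pi) *
    phi1 omega r ((l k - l j)%:~R * sampling_step omega r)).

Definition S22 (R : realType) (omega r : R) (N : nat) (l : 'I_N -> int) :
    'M[R]_N :=
  \matrix_(k, j) (- Num.sqrt (2 * pi) *
    derive1 (phi2 omega r) ((l k - l j)%:~R * sampling_step omega r)).

(* lam lists the eigenvalues of A with multiplicity, in any order.  Over R this
   also requires char_poly A to split, which real_symmetric_eigenvalues below
   guarantees for every symmetric A. *)
Definition eigenvalues_of (R : realType) (N : nat) (A : 'M[R]_N)
    (lam : 'I_N -> R) : Prop :=
  char_poly A = \prod_(j < N) ('X - (lam j)%:P).

Lemma eigenvalues_ofP (R : realType) (N : nat) (A : 'M[R]_N)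
    (lam : 'I_N -> R) (a : R) :
  eigenvalues_of A lam -> (eigenvalue A a <-> exists j, lam j = a).
Proof.
move=> H; rewrite eigenvalue_root_char H.
rewrite -(big_map lam predT (fun x => 'X - x%:P)) root_prod_XsubC.
split=> [/mapP[j _ ->]|[j <-]]; first by exists j.
by apply: map_f; rewrite mem_index_enum.
Qed.

Lemma real_symmetric_eigenvalues (R : realType) (N : nat) (A : 'M[R]_N) :
  A^T = A -> exists lam, eigenvalues_of A lam.
Proof.
move=> AT; pose f : {rmorphism R -> R[i]} := real_complex R.
pose B := map_mx f A.
have Bh : B \is hermsymmx.
  apply: realsym_hermsym.
    apply/is_hermitianmxP; rewrite expr0 scale1r map_mx_id //.
    by rewrite /B map_trmx AT.
  by apply/mxOverP => i j; rewrite mxE complex_real.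
have /mxOverP dr := hermitian_spectral_diag_real Bh.
set d := spectral_diag B in dr.
pose P := spectralmx B.
have Pu : P \in unitmx := spectral_unit B.
have eB : P *m B = diag_mx d *m P.
  have /orthomx_spectralP {1}-> := hermitian_normalmx Bh.
  by rewrite !mulmxA mulmxV // mul1mx.
have cB : char_poly B = \prod_(j < N) ('X - (d 0 j)%:P).
  have := char_poly_trig (diag_mx_is_trig d).
  under eq_bigr do rewrite mxE eqxx mulr1n.
  move=> <-; pose P' := map_mx polyC P.
  have P'0 : \det P' != 0.
    by rewrite det_map_mx polyC_eq0 -unitfE -unitmxE.
  apply: (mulfI P'0); rewrite mulrC [RHS]mulrC /char_poly.
  rewrite [LHS]mulrC -!det_mulmx; congr (\det _).
  rewrite /char_poly_mx mulmxBr mulmxBl -!map_mxM eB.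
  by rewrite scalar_mxC.
exists (fun j => complex.Re (d 0 j)).
apply: (map_poly_inj f); rewrite map_char_poly rmorph_prod /= [LHS]cB.
by apply: eq_bigr => j _; rewrite rmorphB /= map_polyX map_polyC /= RRe_real.
Qed.

Lemma derive1_odd (R : realType) (f : R -> R) :
  (forall x, f (- x) = - f x) -> forall x, derive1 f (- x) = derive1 f x.
Proof.
move=> fN x; rewrite /derive1; congr (lim _).
set g := (fun h => _); set k := (fun h => _).
have -> : g = k \o -%R.
  apply/funext => h /=; rewrite /g /k /= invrN.
  have -> : h - x = - (- h + x) by rewrite opprD opprK.
  by rewrite !fN scaleNr -scalerN opprB opprK addrC.
suff -> : (k \o -%R) @ 0^' = k @ 0^' by [].
have N0 (A : set R) : 0^' A -> 0^' (-%R @^-1` A).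
  case=> e /= e0 eA; exists e => //= y; rewrite /= sub0r normrN => ye y0.
  by apply: eA; rewrite /= ?sub0r ?normrN ?oppr_eq0.
apply/seteqP; split=> A /N0 //=.
by rewrite -comp_preimage; congr (0^' _); apply/funext => h /=; rewrite opprK.
Qed.

Lemma sincN (R : realType) (x : R) : sinc (- x) = sinc x.
Proof. by rewrite /sinc oppr_eq0 sinN invrN mulrNN. Qed.

Lemma S11_sym (R : realType) (omega r : R) (N : nat) (l : 'I_N -> int) :
  (S11 omega r l)^T = S11 omega r l.
Proof.
apply/matrixP => k j; rewrite !mxE -opprB rmorphN mulNr /phi1.
by rewrite mulrN mulNr !sincN.
Qed.

Lemma S22_sym (R : realType) (omega r : R) (N : nat) (l : 'I_N -> int) :
  (S22 omega r l)^T = S22 omega r l.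
Proof.
apply/matrixP => k j; rewrite !mxE -opprB rmorphN.
rewrite [X in derive1 _ X]mulNr derive1_odd // => x.
by rewrite /phi2 !(mulrN, mulNr) sincN.
Qed.

(* Main.v *)
Require Import Defs.
From HB Require Import structures.
From mathcomp Require Import all_boot all_order all_algebra.
From mathcomp Require Import all_classical all_reals all_analysis.
From mathcomp Require Import ring lra.
Set Implicit Arguments.
Unset Strict Implicit.
Unset Printing Implicit Defensive.
Import Order.TTheory GRing.Theory Num.Theory.
Import numFieldNormedType.Exports.
Local Open Scope ring_scope.

(** The entries of S11 and S22 are cosine coefficients of explicit weights:
    with x = l_k - l_j they equal the integrals over [-r, r] of
    (1 - |t|) cos (2 pi x t) and of |t| cos (2 pi x t).  When every l_k is
    m i_k, the substitution s = m t and folding the line onto one period turn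
    both into integrals over [-1/2, 1/2] of w(s) cos (2 pi (i_k - i_j) s),
    where w is the even, 1-periodic sum of the translates of the rescaled weight.  Hence
    the quadratic form of the matrix at v is the integral of
    w(s) |sum_k v_k exp (2 pi I i_k s)|^2, and every eigenvalue lies between the
    extreme values of w.

    Let b be the integer nearest to m r and eta = |m r - b|, so m r = b + sg eta
    with sg = 1 or sg = -1.  The number of translates covering s changes only
    at s = eta, so on [0, 1/2] the folded weight is affine, w(s) = A + B s, up to
    eta, and a constant K after eta, where the terms in s cancel pairwise.  Since
    D = 2 b or D = 2 b - 1 according to sg, comparing A + B s and K with alpha
    and beta is linear arithmetic in b.  The comparison is strict on (0, eta),
    an interval that is nonempty because m r is not an integer.  Strictness
    passes to the eigenvalues because a trigonometric sum with distinct
    frequencies and coefficients not all zero cannot vanish on an interval.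

    The integrals are handled through primitives.  [two_step_coef] is the cosine
    coefficient of a two-piece weight, written with an explicit primitive;
    [two_step_form_gt0] is positivity of the quadratic form, obtained from the
    monotonicity of that primitive; [S11_two_step] and [S22_two_step] identify
    the matrix entries.  Both sides of those identities are closed trigonometric
    expressions and m r differs from sg eta by an integer, so folding reduces to
    periodicity of sin and cos. *)

(** * Calculus on intervals *)

Lemma le_of_derive_ge0 (R : realType) (f df : R -> R) (a b : R) :
  (forall x : R, is_derive x (1 : R) f (df x)) -> a <= b ->
  (forall x, a < x < b -> 0 <= df x) -> f a <= f b.
Proof.
move=> f_df; rewrite le_eqVlt => /predU1P[-> //|a_b] df_ge0.
have f_cont : ({within `[a, b], continuous f})%classic.
  by apply: derivable_within_continuous => x _; have [] := f_df x.
have [x x_ab /eqP] := MVT a_b (fun x _ => f_df x) f_cont.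
rewrite subr_eq => /eqP ->; rewrite lerDr mulr_ge0 ?subr_ge0 ?(ltW a_b) //.
by apply: df_ge0; move: x_ab; rewrite in_itv.
Qed.

Lemma derive_eq0_of_const (R : realType) (f df : R -> R) (a b y : R) :
  (forall x : R, is_derive x (1 : R) f (df x)) ->
  (forall x, a < x < b -> f x = y) -> forall x, a < x < b -> df x = 0.
Proof.
move=> f_df f_cst x x_ab; have /andP[a_x x_b] := x_ab.
have [||||_ f0] := @derive1_at_max R f a b x.
- exact: ltW (lt_trans a_x x_b).
- by move=> t _; have [] := f_df t.
- by rewrite in_itv.
- by move=> t; rewrite in_itv => /= t_ab; rewrite !f_cst.
by have [_ <-] := f_df x.
Qed.

Lemma is_derive_lincomb (R : realType) (n : nat) (c : 'I_n -> R)
    (h dh : 'I_n -> R -> R) (x : R) :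
  (forall k, is_derive x (1 : R) (h k) (dh k x)) ->
  is_derive x (1 : R) (fun s => \sum_(k < n) c k * h k s)
    (\sum_(k < n) c k * dh k x).
Proof.
move=> h_dh; have -> : (fun s => \sum_(k < n) c k * h k s)
    = \sum_(k < n) (c k \*: h k).
  by apply/boolp.funext => s; rewrite fct_sumE.
by apply: is_derive_sum => k; exact: is_deriveZ.
Qed.

Lemma is_derive_scale (R : realType) (f : R -> R) (p x a : R) :
  is_derive (p * x) (1 : R) f a ->
  is_derive x (1 : R) (fun s => f (p * s)) (p * a).
Proof.
move=> f_a; rewrite mulrC; apply: (@is_derive1_comp R f (p \*: id)) => //.
by rewrite -[X in is_derive _ _ _ X]mulr1; exact: is_deriveZ.
Qed.

(** * Cosine coefficients of two-piece weights *)

(** A primitive in s of (A + B s) cos (p s). *)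
Definition affine_cos_primitive (R : realType) (A B p s : R) : R :=
  if p == 0 then A * s + B / 2 * s ^+ 2
  else (A + B * s) * sin (p * s) / p + B * cos (p * s) / p ^+ 2.

Lemma is_derive_affine_cos_primitive (R : realType) (A B p x : R) :
  is_derive x (1 : R) (affine_cos_primitive A B p) ((A + B * x) * cos (p * x)).
Proof.
rewrite /affine_cos_primitive.
have [->|p0] /= := eqVneq p 0.
  have -> : (fun s => A * s + B / 2 * s ^+ 2)
    = A \*: (id : R -> R) + (B / 2) \*: ((id : R -> R) * id).
    by apply/boolp.funext => s /=; rewrite !fctE /GRing.scale /= expr2.
  by apply: is_derive_eq; rewrite /GRing.scale /= mul0r cos0; field.
(* hs and hc feed the type class resolution triggered by is_derive_eq. *)
have hs := is_derive_scale (is_derive_sin (p * x)).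
have hc := is_derive_scale (is_derive_cos (p * x)).
have -> : (fun s => (A + B * s) * sin (p * s) / p + B * cos (p * s) / p ^+ 2)
  = p^-1 \*: ((cst A + B \*: id) * (fun s => sin (p * s)))
    + (B / p ^+ 2) \*: (fun s => cos (p * s)).
  apply/boolp.funext => s /=.
  rewrite !fctE /= /GRing.scale /=; field; exact: p0.
apply: is_derive_eq.
rewrite /GRing.scale /= !fctE.
rewrite (_ : (B \*: (id : R -> R)) x = B * x) //; field; exact: p0.
Qed.

(** The integral over [-1/2, 1/2] of w(s) cos (p s), for the even weight w equal
    to A + B |s| where |s| < eta and to K elsewhere. *)
Definition two_step_coef (R : realType) (A B K eta p : R) : R :=
  2 * (affine_cos_primitive A B p eta - affine_cos_primitive A B p 0)
  + 2 * (affine_cos_primitive K 0 p (1 / 2) - affine_cos_primitive K 0 p eta).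

(** The right-hand side is |sum_k c_k exp (I p_k s)|^2; this is what makes the
    quadratic form of a cosine-difference kernel nonnegative. *)
Lemma quadratic_form_cosB (R : realType) (N : nat) (c p : 'I_N -> R) (s : R) :
  \sum_k c k * (\sum_j c j * cos ((p k - p j) * s)) =
  (\sum_k c k * cos (p k * s)) ^+ 2 + (\sum_k c k * sin (p k * s)) ^+ 2.
Proof.
rewrite !expr2 !mulr_suml -big_split /=; apply: eq_bigr => k _.
rewrite -!mulrA -mulrDr; congr (_ * _); rewrite !mulr_sumr -big_split /=.
by apply: eq_bigr => j _; rewrite mulrBl cosB; ring.
Qed.

(** * Trigonometric sums that vanish on an interval *)

Section TrigIndependence.
Variables (R : realType) (N : nat) (p : 'I_N -> R) (a b : R).

Let vanishing (c : 'I_N -> R) := forall s, a < s < b ->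
  \sum_k c k * cos (p k * s) = 0 /\ \sum_k c k * sin (p k * s) = 0.

(** Differentiating replaces c_k by p_k c_k, up to exchanging the cosine and
    the sine sum; subtracting p_j times the original sums gives the factor
    p_k - p_j. *)
Let vanishing_factors (c : 'I_N -> R) (t : seq 'I_N) :
  vanishing c -> vanishing (fun k => c k * \prod_(j <- t) (p k - p j)).
Proof.
move=> c0; elim: t => [|j t IH].
  move=> s /c0; under [in X in _ -> X]eq_bigr do rewrite big_nil mulr1.
  by under [in X in _ -> _ /\ X]eq_bigr do rewrite big_nil mulr1.
set d := (fun k => c k * \prod_(i <- t) _) in IH => s s_ab.
have [dC dS] := IH s s_ab.
have dcos : \sum_k d k * (p k * - sin (p k * s)) = 0.
  apply: (derive_eq0_of_const (df := fun x => \sum_k d k * (p k * - sin (p k * x)))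
    _ (fun s hs => (IH s hs).1) s_ab) => x.
  apply: (@is_derive_lincomb _ _ d _ (fun k x => p k * - sin (p k * x))) => k.
  exact: is_derive_scale.
have dsin : \sum_k d k * (p k * cos (p k * s)) = 0.
  apply: (derive_eq0_of_const (df := fun x => \sum_k d k * (p k * cos (p k * x)))
    _ (fun s hs => (IH s hs).2) s_ab) => x.
  apply: (@is_derive_lincomb _ _ d _ (fun k x => p k * cos (p k * x))) => k.
  exact: is_derive_scale.
split.
  transitivity (\sum_k d k * (p k * cos (p k * s))
                - p j * \sum_k d k * cos (p k * s)).
    by rewrite mulr_sumr -sumrB; apply: eq_bigr => k _; rewrite big_cons /d; ring.
  by rewrite dsin dC mulr0 subr0.
transitivity (- (\sum_k d k * (p k * - sin (p k * s)))
              - p j * \sum_k d k * sin (p k * s)).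
  rewrite mulr_sumr -sumrN -sumrB; apply: eq_bigr => k _; rewrite big_cons /d.
  by ring.
by rewrite dcos dS mulr0 subr0 oppr0.
Qed.

(** Multiplying each c_j by the product of all p_j - p_i with i <> k, as in
    Lagrange interpolation, kills every coefficient but that of k; at a single
    point the two sums then say that this coefficient is 0. *)
Lemma trig_sum_eq0 (c : 'I_N -> R) : a < b -> injective p ->
  (forall s, a < s < b ->
     \sum_k c k * cos (p k * s) = 0 /\ \sum_k c k * sin (p k * s) = 0) ->
  forall k, c k = 0.
Proof.
move=> a_b p_inj c0 k; pose t := [seq j <- index_enum 'I_N | j != k].
have s_ab : a < (a + b) / 2 < b by apply/andP; split; lra.
have [] := vanishing_factors t c0 s_ab; set s := _ / 2.
have kill (f : R -> R) :
    \sum_(j < N) c j * \prod_(i <- t) (p j - p i) * f (p j * s) =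
    c k * \prod_(i <- t) (p k - p i) * f (p k * s).
  rewrite (bigD1 k) //= [X in _ + X]big1 ?addr0 // => j jk.
  rewrite (big_rem j) /=; last by rewrite mem_filter jk mem_index_enum.
  by rewrite subrr mul0r mulr0 mul0r.
rewrite !kill; set P := \prod_(i <- t) _ => cC cS.
have : (c k * P) ^+ 2 = 0.
  rewrite -[LHS]mulr1 -(cos2Dsin2 (p k * s)) mulrDr -!exprMn cC cS expr0n /=.
  by rewrite addr0.
move/eqP; rewrite expf_eq0 /= mulf_eq0 => /orP[/eqP //|].
rewrite /P prodf_seq_eq0 => /hasP[i]; rewrite mem_filter subr_eq0 => /andP[ik _].
by move=> /andP[_ /eqP /p_inj ki]; rewrite ki eqxx in ik.
Qed.

End TrigIndependence.

(** * Positivity and eigenvalue bounds *)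

(** The form is the integral of the weight times the nonnegative function of
    [quadratic_form_cosB].  If it were not positive, the primitive on [0, eta]
    would be constant, so the trigonometric sums would vanish on (0, eta). *)
Lemma two_step_form_gt0 (R : realType) (N : nat) (A B K eta : R)
    (c p : 'I_N -> R) :
  0 < eta <= 1 / 2 -> (forall s, 0 < s < eta -> 0 < A + B * s) -> 0 <= K ->
  injective p -> (exists k, c k != 0) ->
  0 < \sum_k c k * (\sum_j c j * two_step_coef A B K eta (p k - p j)).
Proof.
move=> /andP[eta0 eta_half] AB0 K0 p_inj [k0 ck0].
pose F A B (s : R) :=
  \sum_k c k * (\sum_j c j * affine_cos_primitive A B (p k - p j) s).
pose Q (s : R) := (\sum_k c k * cos (p k * s)) ^+ 2
                  + (\sum_k c k * sin (p k * s)) ^+ 2.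
have Q0 s : 0 <= Q s by rewrite addr_ge0 ?sqr_ge0.
have F_Q A' B' (s : R) : is_derive s (1 : R) (F A' B') ((A' + B' * s) * Q s).
  rewrite /Q -quadratic_form_cosB mulr_sumr.
  apply: is_derive_eq.
    pose G p s := (A' + B' * s) * cos (p * s).
    apply: (@is_derive_lincomb _ _ c _
      (fun k x => \sum_j c j * G (p k - p j) x)) => k.
    apply: (@is_derive_lincomb _ _ c _ (fun j => G (p k - p j))) => j.
    exact: is_derive_affine_cos_primitive.
  apply: eq_bigr => k _; rewrite [RHS]mulrCA; congr (_ * _); rewrite mulr_sumr.
  by apply: eq_bigr => j _; rewrite mulrCA.
have -> : \sum_k c k * (\sum_j c j * two_step_coef A B K eta (p k - p j)) =
    2 * (F A B eta - F A B 0) + 2 * (F K 0 (1 / 2) - F K 0 eta).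
  rewrite /F -!sumrB !mulr_sumr -big_split /=; apply: eq_bigr => k _.
  rewrite -!mulrBr -!sumrB !(mulrCA 2) -mulrDr; congr (_ * _).
  rewrite !mulr_sumr -big_split /=.
  by apply: eq_bigr => j _; rewrite /two_step_coef; ring.
have FK : F K 0 eta <= F K 0 (1 / 2).
  apply: le_of_derive_ge0 (F_Q K 0) eta_half _ => s _.
  by rewrite mul0r addr0 mulr_ge0.
have FAB s t : 0 <= s -> s <= t -> t <= eta -> F A B s <= F A B t.
  move=> s0 st t_eta; apply: le_of_derive_ge0 (F_Q A B) st _ => u /andP[su ut].
  by rewrite mulr_ge0 // ltW // AB0 // (le_lt_trans s0) //= (lt_le_trans ut).
have : F A B 0 <= F A B eta by rewrite FAB // ltW.
rewrite le_eqVlt => /predU1P[Feq|]; last by lra.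
have Q_eq0 s : 0 < s < eta -> Q s = 0.
  move=> s_eta; have : (A + B * s) * Q s = 0.
    apply: (@derive_eq0_of_const _ _ (fun s => (A + B * s) * Q s) _ _ (F A B 0)
      (F_Q A B) _ _ s_eta) => t /andP[t0 t1].
    apply/le_anti; rewrite {1}Feq !FAB // ltW //.
  by move/eqP; rewrite mulf_eq0 gt_eqF ?AB0 //= => /eqP.
have [] := negP ck0; apply/eqP; move: k0 {ck0}.
apply: (@trig_sum_eq0 _ _ p 0 eta) => // s /Q_eq0 /eqP.
rewrite paddr_eq0 ?sqr_ge0 // !expf_eq0 /=.
by move=> /andP[/eqP ? /eqP ?].
Qed.

Lemma two_step_coefB (R : realType) (A A' B B' K K' eta p : R) :
  two_step_coef (A - A') (B - B') (K - K') eta p =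
  two_step_coef A B K eta p - two_step_coef A' B' K' eta p.
Proof.
by rewrite /two_step_coef /affine_cos_primitive; case: eqVneq => [_|p0]; field.
Qed.

Lemma sinD_2pi_int (R : realType) (x : R) (d : int) :
  sin (x + 2 * pi * d%:~R) = sin x.
Proof.
have per y n : sin (y + 2 * pi * n%:R) = sin y :> R.
  by rewrite -[RHS](periodicn (@sinD2pi R) n) mulr_natr mulr_natl.
case: d => n; first exact: per.
by rewrite NegzE -[LHS](per _ n.+1) rmorphN mulrN subrK.
Qed.

Lemma cosD_2pi_int (R : realType) (x : R) (d : int) :
  cos (x + 2 * pi * d%:~R) = cos x.
Proof. by rewrite -!sinDpihalf addrAC sinD_2pi_int. Qed.

Lemma sin_pi_int (R : realType) (d : int) : sin (pi * d%:~R) = 0 :> R.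
Proof.
have := sinD_2pi_int (- (pi * d%:~R) : R) d.
rewrite (_ : _ + _ = pi * d%:~R :> R); last by ring.
by rewrite sinN; lra.
Qed.

(** A constant weight gives a multiple of the identity matrix, by orthogonality
    over a period; this is why subtracting a constant from the weight shifts
    the eigenvalues. *)
Lemma two_step_coef_cst (R : realType) (a eta : R) (d : int) :
  two_step_coef a 0 a eta (2 * pi * d%:~R) = a *+ (d == 0).
Proof.
have q_half : sin (2 * pi * d%:~R * (1 / 2)) = 0 :> R.
  by rewrite -(sin_pi_int R d); congr sin; field.
have q_eq0 : (2 * pi * d%:~R == 0 :> R) = (d == 0).
  by rewrite !mulf_eq0 pnatr_eq0 (gt_eqF (pi_gt0 R)) intr_eq0.
move: (2 * pi * _) q_half q_eq0 => q q_half.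
rewrite /two_step_coef /affine_cos_primitive => <-.
have [_|q0] := eqVneq q 0; first by rewrite mulr1n; field.
by rewrite q_half !mulr0 sin0 mulr0n; field.
Qed.

(** Positivity is applied to the weights w - lo and hi - w, with an eigenvector
    for lam. *)
Lemma two_step_eigenvalue_bounds (R : realType) (N : nat) (S : 'M[R]_N)
    (i : 'I_N -> int) (A B K eta lo hi lam : R) :
  injective i -> 0 < eta <= 1 / 2 ->
  (forall k j, S k j = two_step_coef A B K eta (2 * pi * (i k - i j)%:~R)) ->
  (forall s, 0 < s < eta -> lo < A + B * s < hi) -> lo <= K <= hi ->
  eigenvalue S lam -> lo < lam < hi.
Proof.
move=> i_inj eta_itv SE AB_itv /andP[loK Khi] /eigenvalueP[v vS v0].
have p_inj : injective (fun k => 2 * pi * (i k)%:~R : R).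
  move=> k j /mulfI /intr_inj-/(_ _)/i_inj; apply.
  by rewrite mulf_neq0 ?pnatr_eq0 // gt_eqF ?pi_gt0.
have vk : exists k, v 0 k != 0.
  apply/existsP; apply: contraT => /existsPn v_eq0; case/negP: v0.
  by apply/eqP/rowP => k; rewrite mxE; apply/eqP; rewrite -[_ == _]negbK v_eq0.
have form_S : \sum_k v 0 k * (\sum_j v 0 j * S k j) = lam * \sum_k v 0 k ^+ 2.
  under eq_bigr do rewrite mulr_sumr.
  rewrite exchange_big mulr_sumr; apply: eq_bigr => j _ /=.
  have := congr1 (fun u : 'rV_N => u 0 j) vS; rewrite !mxE => vSj.
  rewrite expr2 mulrA -vSj mulr_suml; apply: eq_bigr => k _.
  by rewrite mulrCA mulrC.
have form_1 a : \sum_k v 0 k * (\sum_j v 0 j * (a *+ (i k - i j == 0))) =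
    a * \sum_k v 0 k ^+ 2.
  rewrite mulr_sumr; apply: eq_bigr => k _; rewrite (bigD1 k) //= big1 ?addr0.
    by rewrite subrr eqxx mulr1n mulrA -expr2 mulrC.
  by move=> j jk; rewrite subr_eq0 (inj_eq i_inj) eq_sym (negPf jk) mulr0.
have formB (X Y : 'I_N -> 'I_N -> R) :
    \sum_k v 0 k * (\sum_j v 0 j * (X k j - Y k j)) =
    \sum_k v 0 k * (\sum_j v 0 j * X k j) - \sum_k v 0 k * (\sum_j v 0 j * Y k j).
  rewrite -sumrB; apply: eq_bigr => k _; rewrite -mulrBr -sumrB; congr (_ * _).
  by apply: eq_bigr => j _; rewrite mulrBr.
have v2 : 0 < \sum_k v 0 k ^+ 2.
  have [k v0k] := vk; rewrite (bigD1 k) //= ltr_wpDr ?exprn_even_gt0 //.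
  by apply: sumr_ge0 => j _; exact: sqr_ge0.
apply/andP; split; rewrite -(ltr_pM2r v2) -form_S -form_1 -subr_gt0 -formB.
  have := @two_step_form_gt0 _ _ (A - lo) (B - 0) (K - lo) eta _ _ eta_itv _ _ p_inj vk.
  under eq_bigr do under eq_bigr do
    rewrite -mulrBr -rmorphB two_step_coefB two_step_coef_cst -SE.
  by apply; [move=> s /AB_itv; lra|lra].
have := @two_step_form_gt0 _ _ (hi - A) (0 - B) (hi - K) eta _ _ eta_itv _ _ p_inj vk.
under eq_bigr do under eq_bigr do
  rewrite -mulrBr -rmorphB two_step_coefB two_step_coef_cst -SE.
by apply; [move=> s /AB_itv; lra|lra].
Qed.

(** * The sinc function and the derivative of phi2 *)

Lemma sin_half_sqr (R : realType) (x : R) : sin (x / 2) ^+ 2 = (1 - cos x) / 2.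
Proof.
have := cos_mulr2n (x / 2); rewrite (_ : x / 2 *+ 2 = x); last by field.
by rewrite cos2sin2 => ->; field.
Qed.

Lemma mul_sinc (R : realType) (x : R) : x * sinc x = sin x.
Proof.
rewrite /sinc; case: eqVneq => [->|x0]; first by rewrite mul0r sin0.
by rewrite mulrC divfK.
Qed.

(** The Caratheodory slope function of sin at 0 is sinc. *)
Lemma continuous_sinc0 (R : realType) : {for (0 : R), continuous (@sinc R)}.
Proof.
have [g [sinE g_cont g0]] := (is_derive1_caratheodory _ _ _).1 (is_derive_sin (0 : R)).
suff -> : @sinc R = g by [].
apply/boolp.funext => x; rewrite /sinc.
case: eqVneq => [->|x0]; first by rewrite g0 cos0.
by have := sinE x; rewrite sin0 !subr0 => ->; rewrite mulfK.
Qed.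

(** Away from 0, x sinc(omega x / 2)^2 is 2 (1 - cos (omega x)) / (omega^2 x).
    At 0 the slope of phi2 is a multiple of sinc^2, which is continuous there. *)
Lemma derive1_phi2 (R : realType) (omega r x : R) : omega != 0 ->
  derive1 (phi2 omega r) x = - (Num.sqrt (2 * pi))^-1 * r ^+ 2 *
    (2 * sinc (omega * x) - sinc (omega * x / 2) ^+ 2).
Proof.
move=> omega0; rewrite derive1E; set C := _ * r ^+ 2.
suff [_ ->] : is_derive x (1 : R) (phi2 omega r)
   (C * (2 * sinc (omega * x) - sinc (omega * x / 2) ^+ 2)) by [].
have [->|x0] := eqVneq x 0.
  apply/is_derive1_caratheodory.
  exists (fun z => C * sinc (omega / 2 * z) ^+ 2); split.
  - move=> z; rewrite /phi2 -/C !mulr0 mul0r subr0.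
    rewrite (_ : omega * z / 2 = omega / 2 * z); last by field.
    by ring.
  - have cont_arg : {for (0 : R), continuous (fun z : R => sinc (omega / 2 * z))}.
      apply: continuous_comp; first exact: mulrl_continuous.
      by rewrite mulr0; exact: continuous_sinc0.
    apply: continuousM; first exact: cst_continuous.
    exact: continuousM.
  - rewrite !mulr0 mul0r /sinc eqxx; ring.
have phi2E : phi2 omega r =
    (2 * C / omega ^+ 2) \*: ((fun y => y^-1) * (cst 1 - (fun y => cos (omega * y)))).
  apply/boolp.funext => y; rewrite !fctE /= /GRing.scale /= /phi2 -/C.
  have [->|y0] := eqVneq y 0; first by rewrite invr0 !(mulr0, mul0r).
  have := sin_half_sqr (omega * y); rewrite -mul_sinc exprMn.
  move: (sinc _) (cos _) => s c sE.
  have -> : 1 - c = 2 * ((omega * y / 2) ^+ 2 * s ^+ 2) by rewrite sE; field.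
  field.
  by rewrite y0 omega0.
(* hc and hV feed the type class resolution triggered by is_derive_eq. *)
have hc := is_derive_scale (is_derive_cos (omega * x)).
have hV := is_deriveV x0 (is_derive_id x (1 : R)).
rewrite phi2E; apply: is_derive_eq.
rewrite /GRing.scale /= !fctE.
have := sin_half_sqr (omega * x); rewrite -mul_sinc exprMn.
rewrite -(mul_sinc (omega * x)).
move: (sinc (omega * x)) (sinc _) (cos _) => s' s c sE.
have -> : 1 - c = 2 * ((omega * x / 2) ^+ 2 * s ^+ 2) by rewrite sE; field.
field.
by rewrite x0 omega0.
Qed.

(** * Matrix entries as cosine coefficients *)

(** Folding onto one period: q rho and q sg eta differ by a multiple of 2 pi. *)
Lemma sinc_folded (R : realType) (rho eta sg : R) (b d : int) :
  sg = 1 \/ sg = -1 -> rho = b%:~R + sg * eta -> rho != 0 -> d != 0 ->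
  let q := 2 * pi * d%:~R in
  [/\ q != 0, sinc (q * rho) = sg * sin (q * eta) / (q * rho) &
      sinc (q * rho / 2) ^+ 2 = 2 * (1 - cos (q * eta)) / (q * rho) ^+ 2].
Proof.
move=> sg_pm rhoE rho0 d0 q.
have q0 : q != 0 by rewrite !mulf_neq0 ?pnatr_eq0 ?intr_eq0 // gt_eqF ?pi_gt0.
have q_rho : q * rho = q * (sg * eta) + 2 * pi * (d * b)%:~R.
  by rewrite rhoE intrM /q; ring.
have sinE : sin (q * rho) = sg * sin (q * eta).
  by rewrite q_rho sinD_2pi_int; case: sg_pm => ->;
    rewrite ?mul1r // !mulN1r mulrN sinN.
have cosE : cos (q * rho) = cos (q * eta).
  by rewrite q_rho cosD_2pi_int; case: sg_pm => ->;
    rewrite ?mul1r // mulN1r mulrN cosN.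
split=> //.
  by rewrite -sinE -mul_sinc [RHS]mulrAC divff ?mul1r // mulf_neq0.
have := sin_half_sqr (q * rho); rewrite -mul_sinc exprMn cosE.
move: (sinc _) (cos _) => s c sE.
have -> : 1 - c = 2 * ((q * rho / 2) ^+ 2 * s ^+ 2) by rewrite sE; field.
by field; rewrite q0 rho0.
Qed.

Section Entries.
Variables (R : realType) (omega r : R) (m N : nat) (i : 'I_N -> int).
Variables (b : int) (sg eta : R).
Let M : R := m%:R.
Let l (k : 'I_N) := m%:Z * i k.
Hypotheses (omega0 : omega != 0) (r0 : r != 0) (m_gt0 : (0 < m)%N).
Hypotheses (sg_pm : sg = 1 \/ sg = -1) (rhoE : M * r = b%:~R + sg * eta).

Let M0 : M != 0. Proof. by rewrite pnatr_eq0 -lt0n. Qed.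

Let sampling_arg k j :
  omega * ((l k - l j)%:~R * sampling_step omega r) =
  2 * pi * (i k - i j)%:~R * (M * r).
Proof.
rewrite /l -mulrBr intrM /sampling_step -/(M) /=.
move: pi (_ - _)%:~R => p d; rewrite -[m%:~R]/M; field; exact: omega0.
Qed.

Let rE : r = (b%:~R + sg * eta) / M. Proof. by rewrite -rhoE mulrC mulKf. Qed.

(** For |s| < eta the translates s + n inside [- m r, m r] number 2 b + sg, and
    the sum of |s + n| over them is b^2 + sg b + |s|; beyond eta they number 2 b
    with sum b^2.  The weight is the sum of (1 - |s + n| / m) / m. *)
Lemma S11_two_step k j :
  S11 omega r l k j =
  two_step_coef ((2 * b%:~R + sg) / M - (b%:~R ^+ 2 + sg * b%:~R) / M ^+ 2)
    (- (1 / M ^+ 2)) (2 * b%:~R / M - b%:~R ^+ 2 / M ^+ 2) eta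
    (2 * pi * (i k - i j)%:~R).
Proof.
rewrite mxE /phi1 mulrA divff ?mul1r; last first.
  by rewrite sqrtr_eq0 -ltNge mulr_gt0 ?pi_gt0.
rewrite sampling_arg /two_step_coef /affine_cos_primitive.
have [->|d0] := eqVneq (i k - i j) 0.
  rewrite mulr0 eqxx !mul0r /sinc eqxx rE.
  by case: sg_pm => ->; field.
have [q0 -> ->] := sinc_folded sg_pm rhoE (mulf_neq0 M0 r0) d0.
rewrite (negPf q0).
rewrite (_ : 2 * pi * (i k - i j)%:~R * (1 / 2) = pi * (i k - i j)%:~R); last by field.
rewrite sin_pi_int !mulr0 sin0 cos0.
have rho0 : M * r != 0 by rewrite mulf_neq0.
rewrite rhoE in rho0; move: q0 rE rho0; rewrite rhoE.
move: (2 * pi * _) => q q0 -> rho0; move: (sin _) (cos _) => s c.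
by case: sg_pm rho0 => ->; rewrite ?mul1r ?mulN1r => rho0; field; rewrite M0 q0 rho0.
Qed.

(** The same translates, now with weight |s + n| / m^2. *)
Lemma S22_two_step k j :
  S22 omega r l k j =
  two_step_coef ((b%:~R ^+ 2 + sg * b%:~R) / M ^+ 2)
    (1 / M ^+ 2) (b%:~R ^+ 2 / M ^+ 2) eta
    (2 * pi * (i k - i j)%:~R).
Proof.
have cancel (s e : R) : s != 0 -> - s * (- s^-1 * r ^+ 2 * e) = r ^+ 2 * e.
  by move=> s0; field.
rewrite mxE derive1_phi2 // cancel; last first.
  by rewrite sqrtr_eq0 -ltNge mulr_gt0 ?pi_gt0.
rewrite sampling_arg /two_step_coef /affine_cos_primitive.
have [->|d0] := eqVneq (i k - i j) 0.
  rewrite mulr0 eqxx !mul0r /sinc eqxx rE.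
  by case: sg_pm => ->; field.
have [q0 -> ->] := sinc_folded sg_pm rhoE (mulf_neq0 M0 r0) d0.
rewrite (negPf q0).
rewrite (_ : 2 * pi * (i k - i j)%:~R * (1 / 2) = pi * (i k - i j)%:~R); last by field.
rewrite sin_pi_int !mulr0 sin0 cos0.
have rho0 : M * r != 0 by rewrite mulf_neq0.
rewrite rhoE in rho0; move: q0 rE rho0; rewrite rhoE.
move: (2 * pi * _) => q q0 -> rho0; move: (sin _) (cos _) => s c.
by case: sg_pm rho0 => ->; rewrite ?mul1r ?mulN1r => rho0; field; rewrite M0 q0 rho0.
Qed.

End Entries.

(** * The bounds *)

(** The sign of m r - b decides the parity of D = floor (2 m r).  The range of b
    differs in the two cases because 0 < rho < m leaves room for the nearest
    integer to be 0 only when it is rounded down, and m only when rounded up. *)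
Lemma nearest_int_split (R : realType) (m : nat) (rho : R) :
  0 < rho < m%:R -> rho \isn't a Num.int ->
  exists (b : int) (sg eta : R), [/\ rho = b%:~R + sg * eta, 0 < eta <= 1 / 2 &
    [/\ sg = 1, Num.floor (2 * rho) = 2 * b & 0 <= (b%:~R : R) <= m%:R - 1] \/
    [/\ sg = -1, Num.floor (2 * rho) = 2 * b - 1 & 1 <= (b%:~R : R) <= m%:R]].
Proof.
move=> /andP[rho0 rho_m] rho_nint.
have := floor_itv rho; set a := Num.floor rho; rewrite intrD => /andP[a_rho rho_a1].
have a_lt : a%:~R < rho.
  rewrite lt_neqAle a_rho andbT; apply: contra rho_nint => /eqP <-.
  exact: intr_int.
have a0 : 0 <= a by rewrite floor_ge0 ltW.
have a_m : a + 1 <= m%:Z.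
  by rewrite lezD1 -(ltr_int R) (le_lt_trans a_rho).
have a0R : 0 <= a%:~R :> R by rewrite ler0z.
have a_mR : a%:~R + 1 <= m%:R :> R by move: a_m; rewrite -(ler_int R) intrD.
have [half|half] := ltP (2 * rho) (2 * a%:~R + 1).
  exists a, 1, (rho - a%:~R); split; [by ring|by apply/andP; split; lra|left].
  split=> //; last by apply/andP; split; lra.
  by apply: floor_def; rewrite !intrD intrM; apply/andP; split; lra.
exists (a + 1), (-1), (a%:~R + 1 - rho); rewrite intrD.
split; [by ring|by apply/andP; split; lra|right].
split=> //; last by apply/andP; split; lra.
apply: floor_def; rewrite !(intrD, intrM, intrN); apply/andP; split; lra.
Qed.

Theorem theorem4p2 (R : realType) (omega r : R) (m N : nat) (i : 'I_N -> int)
    (omega_gt0 : 0 < omega) (r_gt0 : 0 < r) (r_lt1 : r < 1)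
    (m_gt0 : (0 < m)%N) (N_gt0 : (0 < N)%N) (i_inj : injective i)
    (mr_nint : m%:R * r \isn't a Num.int) :
  let l := fun k : 'I_N => m%:Z * i k in
  let M := m%:R : R in
  let D := (Num.floor (2 * M * r))%:~R : R in
  let alpha11 := D / M * (1 - D / (4 * M) - 1 / (4 * M)) in
  let beta11 := alpha11 + 1 / M in
  let alpha22 := D / (4 * M ^+ 2) * (D - 1) in
  let beta22 := D / (4 * M ^+ 2) * (D + 1) + r / M in
  forall lam11 lam22 : 'I_N -> R,
    eigenvalues_of (S11 omega r l) lam11 ->
    eigenvalues_of (S22 omega r l) lam22 ->
    forall j : 'I_N,
      alpha11 < lam11 j < beta11 /\ alpha22 < lam22 j < beta22.
Proof.
move=> l M D alpha11 beta11 alpha22 beta22 lam11 lam22 eig11 eig22 j.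
have M_gt0 : 0 < M by rewrite ltr0n.
have M0 : M != 0 by rewrite gt_eqF.
have rho_itv : 0 < M * r < m%:R by rewrite mulr_gt0 //= -/M gtr_pMr.
have [b [sg [eta [rhoE eta_itv branch]]]] := nearest_int_split rho_itv mr_nint.
have sg_pm : sg = 1 \/ sg = -1 by case: branch => [[-> _ _]|[-> _ _]]; [left|right].
have omega0 : omega != 0 by rewrite gt_eqF.
have r0 : r != 0 by rewrite gt_eqF.
have ev11 : eigenvalue (S11 omega r l) (lam11 j).
  by apply/(eigenvalues_ofP _ eig11); exists j.
have ev22 : eigenvalue (S22 omega r l) (lam22 j).
  by apply/(eigenvalues_ofP _ eig22); exists j.
have S11E := S11_two_step i omega0 r0 m_gt0 sg_pm rhoE.
have S22E := S22_two_step i omega0 r0 m_gt0 sg_pm rhoE.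
have M2 : 0 < M ^+ 2 by rewrite exprn_gt0.
(* All comparisons are cleared of denominators, which makes them linear in the
   atoms b, b M, b^2, s and eta. *)
have scale_lt (x y z : R) :
    (x < y < z) = (x * M ^+ 2 < y * M ^+ 2 < z * M ^+ 2).
  by rewrite !ltr_pM2r.
have scale_le (x y z : R) :
    (x <= y <= z) = (x * M ^+ 2 <= y * M ^+ 2 <= z * M ^+ 2).
  by rewrite !ler_pM2r.
have a11 : alpha11 * M ^+ 2 = D * M - D ^+ 2 / 4 - D / 4.
  by rewrite /alpha11; field.
have b11 : beta11 * M ^+ 2 = D * M - D ^+ 2 / 4 - D / 4 + M.
  by rewrite mulrDl a11; congr (_ + _); field.
have a22 : alpha22 * M ^+ 2 = D ^+ 2 / 4 - D / 4.
  by rewrite /alpha22; field.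
have b22 : beta22 * M ^+ 2 = D ^+ 2 / 4 + D / 4 + (b%:~R + sg * eta).
  by rewrite -rhoE /beta22 -/M; field.
have DE : D = (Num.floor (2 * (M * r)))%:~R by rewrite mulrA.
have clear_K11 (x y : R) : (x / M - y / M ^+ 2) * M ^+ 2 = x * M - y by field.
have clear_K22 (y : R) : y / M ^+ 2 * M ^+ 2 = y by field.
have clear_aff11 (x y s : R) :
  (x / M - y / M ^+ 2 + - (1 / M ^+ 2) * s) * M ^+ 2 = x * M - y - s by field.
have clear_aff22 (y s : R) :
  (y / M ^+ 2 + 1 / M ^+ 2 * s) * M ^+ 2 = y + s by field.
split.
  apply: (two_step_eigenvalue_bounds i_inj eta_itv S11E _ _ ev11); last first.
    rewrite scale_le a11 b11 clear_K11 DE.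
    by case: branch => -[sgE -> /andP[b_ge b_le]];
    rewrite ?sgE ?intrB intrM /M; apply/andP; split; lra.
  move=> s /andP[s0 s_eta]; rewrite scale_lt a11 b11 clear_aff11 DE.
  by case: branch => -[sgE -> /andP[b_ge b_le]];
    rewrite ?sgE ?intrB intrM /M; apply/andP; split; lra.
apply: (two_step_eigenvalue_bounds i_inj eta_itv S22E _ _ ev22); last first.
  rewrite scale_le a22 b22 clear_K22 DE.
  by case: branch => -[sgE -> /andP[b_ge b_le]];
    rewrite ?sgE ?intrB intrM /M; apply/andP; split; lra.
move=> s /andP[s0 s_eta]; rewrite scale_lt a22 b22 clear_aff22 DE.
by case: branch => -[sgE -> /andP[b_ge b_le]];
    rewrite ?sgE ?intrB intrM /M; apply/andP; split; lra.
Qed.
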